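(* Let $\mathbb{F}$ be a field with $\operatorname{char}\mathbb{F}\ne 2$ and $\sqrt{2}\in\mathbb{F}$ (that is, $2$ is a square in $\mathbb{F}$). Let $W_3=b_2\otimes b_1\otimes b_1+b_1\otimes b_2\otimes b_1+b_1\otimes b_1\otimes b_2\in(\mathbb{F}^2)^{\otimes 3}$, where $b_1,b_2$ is the standard basis of $\mathbb{F}^2$. Then $\mathrm{R}(W_3^{\otimes 2})\le 8<9=\mathrm{R}(W_3)^2$.
   Context: The tensor rank $\mathrm{R}(t)$ of a $k$-tensor $t\in U_1\otimes\cdots\otimes U_k$ over $\mathbb{F}$ is the smallest $r$ such that $t$ is a sum of $r$ simple tensors $u_1\otimes\cdots\otimes u_k$. The tensor $W_3^{\otimes 2}=W_3\otimes W_3$ is regarded as a $6$-tensor in $(\mathbb{F}^2)^{\otimes 6}$ (no factors are grouped). *)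

(* Defs.v *)
From HB Require Import structures.
From mathcomp Require Import all_boot all_order all_algebra.
From mathcomp Require Import boolp.

Set Implicit Arguments.
Unset Strict Implicit.
Unset Printing Implicit Defensive.

Import GRing.Theory.
Local Open Scope ring_scope.

(* A k-tensor in F^(d 0) (x) ... (x) F^(d (k-1)) is its array of coordinates
   in the basis of tensor products of standard basis vectors. *)
Definition multi_index (k : nat) (d : 'I_k -> nat) :=
  {dffun forall i : 'I_k, 'I_(d i)}.

Definition tensor (F : fieldType) (k : nat) (d : 'I_k -> nat) :=
  {ffun multi_index d -> F}.

Definition simple_tensor (F : fieldType) (k : nat) (d : 'I_k -> nat)
    (u : forall i : 'I_k, 'rV[F]_(d i)) : tensor F d :=
  [ffun I : multi_index d => \prod_i u i ord0 (I i)].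

Definition sum_of_simple (F : fieldType) (k : nat) (d : 'I_k -> nat)
    (t : tensor F d) (r : nat) : Prop :=
  exists u : 'I_r -> forall i : 'I_k, 'rV[F]_(d i),
    t = \sum_(p < r) simple_tensor (u p).

(* At least one factor is needed: a sum of simple 0-tensors is a sum of ones. *)
Lemma sum_of_simple_ex (F : fieldType) (k : nat) (d : 'I_k.+1 -> nat)
  (t : tensor F d) : exists r, `[< sum_of_simple t r >].
Proof.
exists #|{: multi_index d}|; apply/asboolP.
exists (fun p i => (if i == ord0 then t (enum_val p) else 1)
                     *: delta_mx ord0 (enum_val p i)).
apply/ffunP => J; rewrite sum_ffunE.
rewrite (bigD1 (enum_rank J)) //= big1 ?addr0 => [|p neqp].
  rewrite ffunE enum_rankK big_ord_recl !mxE !eqxx mulr1 big1 ?mulr1 // => i _.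
  by rewrite !mxE !eqxx mulr1.
have [i neqi] : exists i, J i != (enum_val p : multi_index d) i.
  apply/existsP; apply: contraNT neqp => /existsPn eqJ.
  apply/eqP; rewrite -[p]enum_valK; congr enum_rank.
  by apply/ffunP => i; apply/esym/eqP; move: (eqJ i); rewrite negbK.
by rewrite ffunE (bigD1 i) //= !mxE (negbTE neqi) andbF mulr0 mul0r.
Qed.

Definition tensor_rank (F : fieldType) (k : nat) (d : 'I_k.+1 -> nat)
    (t : tensor F d) : nat :=
  ex_minn (sum_of_simple_ex t).

(* (F^n)^{(x) k} *)
Notation tensor_power F n k := (@tensor F k%N (fun _ => n%N)).

(* No grouping of factors: the product of a k-tensor and an l-tensor is a
   (k + l)-tensor. *)
Definition tensor_product (F : fieldType) (n k l : nat)
    (s : tensor_power F n k) (t : tensor_power F n l) :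
    tensor_power F n (k + l) :=
  [ffun I : multi_index (fun _ : 'I_(k + l) => n) =>
     s [ffun i : 'I_k => I (lshift l i)] * t [ffun j : 'I_l => I (rshift k j)]].

Definition b1 (F : fieldType) : 'rV[F]_2 := delta_mx ord0 ord0.
Definition b2 (F : fieldType) : 'rV[F]_2 := delta_mx ord0 ord_max.

Definition simple3 (F : fieldType) (u v w : 'rV[F]_2) : tensor_power F 2 3 :=
  simple_tensor (fun i : 'I_3 => [:: u; v; w]`_i).

Definition W3 (F : fieldType) : tensor_power F 2 3 :=
  simple3 (b2 F) (b1 F) (b1 F) + simple3 (b1 F) (b2 F) (b1 F)
  + simple3 (b1 F) (b1 F) (b2 F).

(* Main.v *)
Require Import Defs.
From HB Require Import structures.
From mathcomp Require Import all_boot all_order all_algebra.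
From mathcomp Require Import boolp ring.

Set Implicit Arguments.
Unset Strict Implicit.
Unset Printing Implicit Defensive.

Import GRing.Theory.
Local Open Scope ring_scope.

(** Write W for [W3 F] and N for the cube b2 (x) b2 (x) b2.

    Upper bound.  The part of (b1 + a b2)^(x)3 that is odd in a is
    a (W + a^2 N), so W + a^2 N is, up to the factor 2 a, the difference of the
    cubes of b1 + a b2 and b1 - a b2: it has rank at most 2 as soon as 2 a is
    invertible ([W3_add_cube_sum_of_simple]).  Now expand the identity
      W (x) W = (W + N) (x) (W + N) - N (x) (W + N/2) - (W + N/2) (x) N.
    The first product takes 2 * 2 simple tensors (a = 1), and the two others
    take 2 each, provided that 1/2 is a square a^2; this is where the square
    root of 2 is needed.  Altogether 4 + 2 + 2 = 8.

    Lower bound.  Suppose that W is a sum of two simple tensors u_p (x) v_p (x)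
    w_p.  Contracting the first factor with a functional f turns W into a
    2 x 2 matrix whose determinant is f(u_1) f(u_2) D, with D independent of f.
    With f = (x, y) this determinant is -x^2, so both linear forms f(u_1) and
    f(u_2) must be multiples of x.  Then the contraction with f = (0, 1)
    vanishes, although it is b1 (x) b1 ([W3_not_sum_of_2_simple]). *)

Lemma sum_of_simple_card (F : fieldType) (k : nat) (d : 'I_k -> nat)
    (P : finType) (u : P -> forall i : 'I_k, 'rV[F]_(d i)) :
  sum_of_simple (\sum_p simple_tensor (u p)) #|P|.
Proof.
by exists (fun p => u (enum_val p)); rewrite [LHS]big_enum_val.
Qed.

Lemma sum_of_simple_add (F : fieldType) (k : nat) (d : 'I_k -> nat)
    (s t : tensor F d) (m n : nat) :
  sum_of_simple s m -> sum_of_simple t n -> sum_of_simple (s + t) (m + n).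
Proof.
move=> [u ->] [v ->].
have := sum_of_simple_card (fun p : 'I_m + 'I_n =>
  match p with inl a => u a | inr b => v b end).
by rewrite big_sumType card_sum !card_ord.
Qed.

Lemma simple_tensor0 (F : fieldType) (k : nat) (d : 'I_k.+1 -> nat) :
  simple_tensor (fun i => 0 : 'rV[F]_(d i)) = 0.
Proof. by apply/ffunP => I; rewrite !ffunE big_ord_recl mxE mul0r. Qed.

Lemma sum_of_simple_leq (F : fieldType) (k : nat) (d : 'I_k.+1 -> nat)
    (t : tensor F d) (m n : nat) :
  (m <= n)%N -> sum_of_simple t m -> sum_of_simple t n.
Proof.
move=> lemn tm; rewrite -(subnKC lemn) -[t]addr0; apply: sum_of_simple_add => //.
exists (fun _ i => 0).
by rewrite big1 // => p _; apply: simple_tensor0.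
Qed.

Lemma tensor_rank_leq (F : fieldType) (k : nat) (d : 'I_k.+1 -> nat)
    (t : tensor F d) (r : nat) :
  (tensor_rank t <= r)%N <-> sum_of_simple t r.
Proof.
rewrite /tensor_rank; case: ex_minnP => m /asboolP tm minm; split=> [lemr|tr].
  exact: sum_of_simple_leq lemr tm.
by apply/minm/asboolP.
Qed.

Lemma tensor_product_simple (F : fieldType) (n k l : nat)
    (u : 'I_k -> 'rV[F]_n) (v : 'I_l -> 'rV[F]_n) :
  tensor_product (simple_tensor u) (simple_tensor v) =
  simple_tensor (fun i : 'I_(k + l) =>
                   match split i with inl a => u a | inr b => v b end).
Proof.
apply/ffunP => I; rewrite !ffunE big_split_ord /=.
congr (_ * _); apply: eq_bigr => i _; rewrite ffunE.
  by rewrite (unsplitK (inl i)).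
by rewrite (unsplitK (inr i)).
Qed.

(** Distributing the product over both sums gives one simple tensor for each
    pair of terms: the rank is submultiplicative. *)
Lemma sum_of_simple_tensor_product (F : fieldType) (n k l : nat)
    (s : tensor_power F n k) (t : tensor_power F n l) (p q : nat) :
  sum_of_simple s p -> sum_of_simple t q ->
  sum_of_simple (tensor_product s t) (p * q).
Proof.
move=> [u ->] [v ->].
have := sum_of_simple_card (fun (ab : 'I_p * 'I_q) (i : 'I_(k + l)) =>
  match split i with inl x => u ab.1 x | inr y => v ab.2 y end).
rewrite card_prod !card_ord; congr sum_of_simple.
apply/ffunP => I; rewrite [in RHS]ffunE !sum_ffunE big_distrlr pair_big /=.
by apply: eq_bigr => ab _; rewrite -tensor_product_simple ffunE.
Qed.

Lemma simple_tensor3E (F : fieldType) (u : 'I_3 -> 'rV[F]_2)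
    (I : multi_index (fun _ : 'I_3 => 2%N)) :
  simple_tensor u I = u ord0 ord0 (I ord0)
    * u (inord 1) ord0 (I (inord 1)) * u (inord 2) ord0 (I (inord 2)).
Proof.
rewrite ffunE !big_ord_recl big_ord0 mulr1 mulrA.
have ->: lift ord0 ord0 = inord 1 :> 'I_3 by apply: val_inj; rewrite /= inordK.
by have ->: lift ord0 (lift ord0 ord0) = inord 2 :> 'I_3
  by apply: val_inj; rewrite /= inordK.
Qed.

Lemma simple3E (F : fieldType) (u v w : 'rV[F]_2) (I : multi_index _) :
  simple3 u v w I =
  u ord0 (I ord0) * v ord0 (I (inord 1)) * w ord0 (I (inord 2)).
Proof. by rewrite [LHS]simple_tensor3E /= !inordK. Qed.

Lemma W3E (F : fieldType) (I : multi_index (fun _ : 'I_3 => 2%N)) :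
  W3 F I = ((I ord0 + I (inord 1) + I (inord 2))%N == 1%N)%:R.
Proof.
rewrite 2!ffunE !simple3E !mxE !eqxx /= -!val_eqE /=.
by case: (I ord0) (I (inord 1)) (I (inord 2))
    => [[|[]] // ?] [[|[]] // ?] [[|[]] // ?] /=;
  rewrite ?mulr1 ?mulr0 ?mul0r ?addr0 ?add0r.
Qed.

Lemma simple3_sum_of_simple (F : fieldType) (u v w : 'rV[F]_2) :
  sum_of_simple (simple3 u v w) 1.
Proof. by exists (fun _ i => [:: u; v; w]`_i); rewrite big_ord1. Qed.

Lemma W3_sum_of_3_simple (F : fieldType) : sum_of_simple (W3 F) 3.
Proof.
exact: (sum_of_simple_add (sum_of_simple_add
  (simple3_sum_of_simple _ _ _) (simple3_sum_of_simple _ _ _))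
  (simple3_sum_of_simple _ _ _)).
Qed.

(** A sum of two rank-one matrices factors through a 2 x 2 diagonal matrix, so
    the determinant of the contraction with f is f(u_1) f(u_2) times
    D = det(v_1, v_2) det(w_1, w_2).  Comparing this product of two linear forms
    with -x^2 kills the coefficients of y in f(u_1) and f(u_2). *)
Lemma W3_not_sum_of_2_simple (F : fieldType) : ~ sum_of_simple (W3 F) 2.
Proof.
move=> [u eqW].
pose f p i := u p ord0 ord0 i; pose g p j := u p (inord 1) ord0 j.
pose h p k := u p (inord 2) ord0 k.
have WE (i j k : 'I_2) : ((i + j + k)%N == 1%N)%:R
    = f ord0 i * g ord0 j * h ord0 k + f ord_max i * g ord_max j * h ord_max k.
  pose I : multi_index (fun _ : 'I_3 => 2%N) :=
    [ffun a : 'I_3 => nth ord0 [:: i; j; k] a].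
  have := W3E F I; rewrite eqW sum_ffunE !big_ord_recl big_ord0 addr0.
  rewrite !simple_tensor3E !ffunE !inordK //= => <-.
  by have ->: lift ord0 ord0 = ord_max :> 'I_2 by apply: val_inj.
pose D := (g ord0 ord0 * g ord_max ord_max - g ord0 ord_max * g ord_max ord0)
        * (h ord0 ord0 * h ord_max ord_max - h ord0 ord_max * h ord_max ord0).
pose W (i j k : 'I_2) : F := ((i + j + k)%N == 1%N)%:R.
(* Coefficients of x^2 and y^2 (slice_det) and of xy (polar_det) in the
   determinant of the contraction with (x, y). *)
have slice_det (i : 'I_2) : f ord0 i * f ord_max i * D =
    W i ord0 ord0 * W i ord_max ord_max - W i ord0 ord_max * W i ord_max ord0.
  by rewrite /W !WE /D; ring.
have polar_det (i i' : 'I_2) :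
    (f ord0 i * f ord_max i' + f ord0 i' * f ord_max i) * D =
    W i ord0 ord0 * W i' ord_max ord_max + W i' ord0 ord0 * W i ord_max ord_max
    - W i ord0 ord_max * W i' ord_max ord0
    - W i' ord0 ord_max * W i ord_max ord0.
  by rewrite /W !WE /D; ring.
clearbody D.
have xx : f ord0 ord0 * f ord_max ord0 * D = - 1.
  by rewrite slice_det /W /= mul0r mulr1 sub0r.
have yy : f ord0 ord_max * f ord_max ord_max * D = 0.
  by rewrite slice_det /W /= mulr0 mulr0 subr0.
have xy : (f ord0 ord0 * f ord_max ord_max + f ord0 ord_max * f ord_max ord0)
    * D = 0.
  by rewrite (polar_det ord0 ord_max) /W /=; ring.
have : f ord0 ord0 * f ord_max ord0 * D != 0 by rewrite xx oppr_eq0 oner_eq0.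
rewrite !mulf_eq0 !negb_or => /andP[/andP[fx0 fx1] D0].
have [fy0 fy1] : f ord0 ord_max = 0 /\ f ord_max ord_max = 0.
  move/eqP: yy xy; rewrite !mulf_eq0 (negbTE D0) orbF.
  case/orP=> /eqP-> /eqP; rewrite mulf_eq0 (negbTE D0) orbF.
    by rewrite mul0r addr0 mulf_eq0 (negbTE fx0) => /eqP.
  by rewrite mulr0 add0r mulf_eq0 (negbTE fx1) orbF => /eqP.
by have /eqP := WE ord_max ord0 ord0; rewrite fy0 fy1 !mul0r addr0 oner_eq0.
Qed.

Lemma tensor_rank_W3 (F : fieldType) : tensor_rank (W3 F) = 3%N.
Proof.
apply/eqP; rewrite eqn_leq ltnNge; apply/andP; split.
  by apply/tensor_rank_leq; exact: W3_sum_of_3_simple.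
by apply/negP => /tensor_rank_leq; exact: W3_not_sum_of_2_simple.
Qed.

(** The tensor is the difference of the cubes of b1 + a b2 and b1 - a b2,
    divided by 2 a: the terms of degree 0 and 2 in a cancel, those of degree 1
    give W and that of degree 3 gives N. *)
Lemma W3_add_cube_sum_of_simple (F : fieldType) (a : F) :
  2%:R * a != 0 ->
  sum_of_simple (W3 F + simple3 (a ^+ 2 *: b2 F) (b2 F) (b2 F)) 2.
Proof.
move=> a0; pose c := (2%:R * a)^-1.
pose v := b1 F + a *: b2 F; pose w := b1 F - a *: b2 F.
have ->: W3 F + simple3 (a ^+ 2 *: b2 F) (b2 F) (b2 F)
    = simple3 (c *: v) v v + simple3 (- c *: w) w w.
  apply/ffunP => I; rewrite ffunE W3E [RHS]ffunE !simple3E !mxE !eqxx /=.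
  have a1 : a != 0 by apply: contraNneq a0 => ->; rewrite mulr0.
  have two0 : 2%:R != 0 :> F by apply: contraNneq a0 => ->; rewrite mul0r.
  rewrite /c -!val_eqE /=.
  by case: (I ord0) (I (inord 1)) (I (inord 2))
      => [[|[]] // ?] [[|[]] // ?] [[|[]] // ?] /=; field; rewrite ?a1 ?two0.
by apply: (@sum_of_simple_add _ _ _ _ _ 1 1); apply: simple3_sum_of_simple.
Qed.

Lemma tensor_rank_W3_square (F : fieldType) (s : F) :
  2%N \notin [pchar F] -> s ^+ 2 = 2%:R ->
  (tensor_rank (tensor_product (W3 F) (W3 F) : tensor_power F 2 6) <= 8)%N.
Proof.
rewrite inE /= => two0 s2.
have s0 : s != 0 by apply: contraNneq two0 => s0; rewrite -s2 s0 expr0n.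
have sq_half : s^-1 ^+ 2 = 2%:R^-1 by rewrite exprVn s2.
pose e := b2 F.
pose A := W3 F + simple3 (1 ^+ 2 *: e) e e.
pose B := W3 F + simple3 (s^-1 ^+ 2 *: e) e e.
pose opN := simple3 (- e) e e.
have A2 : sum_of_simple A 2.
  by apply: W3_add_cube_sum_of_simple; rewrite mulr1.
(* The inverse of s is a square root of 1/2, so B is W + N/2 and opN is -N. *)
have B2 : sum_of_simple B 2.
  by apply: W3_add_cube_sum_of_simple; rewrite mulf_neq0 ?invr_eq0.
have N1 : sum_of_simple opN 1 by apply: simple3_sum_of_simple.
have ->: tensor_product (W3 F) (W3 F)
    = tensor_product A A + tensor_product opN B + tensor_product B opN.
  apply/ffunP => I; rewrite [RHS]ffunE [in RHS]ffunE !(ffunE (fun _ => _ * _)).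
  rewrite /A /B /opN !(ffunE (fun _ => _ + _)) !simple3E !mxE sq_half; field.
  exact: two0.
apply/tensor_rank_leq.
exact: (sum_of_simple_add (sum_of_simple_add
  (sum_of_simple_tensor_product A2 A2) (sum_of_simple_tensor_product N1 B2))
  (sum_of_simple_tensor_product B2 N1)).
Qed.

Theorem proposition14 (F : fieldType)
  (char_neq2 : 2%N \notin [pchar F])
  (sqrt2 : exists s : F, s ^+ 2 = 2%:R) :
  (tensor_rank (tensor_product (W3 F) (W3 F) : tensor_power F 2 6) <= 8 < 9)%N
  /\ 9%N = (tensor_rank (W3 F) ^ 2)%N.
Proof.
case: sqrt2 => s s2.
by rewrite andbT tensor_rank_W3 (tensor_rank_W3_square char_neq2 s2).
Qed.
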